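(* Let $0<r<1$ and $\lambda>0$. (1) $A_\lambda^{QW}:=B_-^{QW}+\sqrt\lambda I$ is injective (i.e. $\ker A_\lambda^{QW}=\{0\}$) if and only if $\lambda\ge\omega$. (2) $0\notin\sigma(P_\lambda^{QW})$ if and only if $\lambda>\omega$.
   Context: Fix $r\in(0,1)$ and let $\omega_1=1-\sqrt{1-r^2}$, $\omega_2=\frac{\sqrt{1-r^2}}{2}\omega_1$, $\omega=\frac{r^2}{4}$, and $\omega_n=\omega$ for $n\ge3$. Let $\mathcal H$ be a complex Hilbert space with complete orthonormal system $\{\Phi_n\}_{n\ge0}$, and let $B_+^{QW},B_-^{QW}$ be the bounded operators with $B_+^{QW}\Phi_n=\sqrt{\omega_{n+1}}\,\Phi_{n+1}$ ($n\ge0$), $B_-^{QW}\Phi_n=\sqrt{\omega_n}\,\Phi_{n-1}$ ($n\ge1$), $B_-^{QW}\Phi_0=0$; they are mutually adjoint. For $\lambda>0$, $P_\lambda^{QW}=(B_+^{QW}+\sqrt\lambda I)(B_-^{QW}+\sqrt\lambda I)=(A_\lambda^{QW})^*A_\lambda^{QW}$. $\sigma(T)$ denotes the spectrum of $T$. *)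

(* Defs.v *)
From HB Require Import structures.
From mathcomp Require Import all_boot all_order all_algebra.
From mathcomp Require Import complex.
From mathcomp Require Import all_classical all_reals all_analysis.

Set Implicit Arguments.
Unset Strict Implicit.
Unset Printing Implicit Defensive.

Import Order.TTheory GRing.Theory Num.Theory.
Import numFieldNormedType.Exports.

Local Open Scope classical_set_scope.
Local Open Scope complex_scope.
Local Open Scope ring_scope.

Section HilbertSpace.
Context {R : realType} {H : completeNormedModType R[i]}.

(* With this condition the Banach space H is a complex Hilbert space with
   inner product ip, linear in its first argument. *)
Definition norm_from_dot (ip : {dot H for Num.conj}) :=
  forall x : H, `|x| ^+ 2 = ip x x.

Definition complete_orthonormal (ip : {dot H for Num.conj}) (Phi : nat -> H) :=
  (forall m n, ip (Phi m) (Phi n) = (m == n)%:R) /\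
  (forall x : H, (forall n, ip x (Phi n) = 0) -> x = 0).

(* For a linear map, boundedness near 0 is the usual operator boundedness,
   see linear_boundedP. *)
Definition bounded_op (T : H -> H) := linear T /\ bounded_near T (nbhs (0 : H)).

Definition resolvent_set (T : H -> H) : set R[i] :=
  [set z | exists S : H -> H, [/\ bounded_op S,
     cancel (fun x => T x - z *: x) S & cancel S (fun x => T x - z *: x)]].

Definition spectrum (T : H -> H) : set R[i] := ~` resolvent_set T.

End HilbertSpace.

Section QuantumWalk.
Context {R : realType}.

Definition omega_qw (r : R) : R := r ^+ 2 / 4.

(* The sequence starts at n = 1; the value at n = 0 is never used. *)
Definition omega_seq (r : R) (n : nat) : R :=
  match n with
  | 0 => 0
  | 1 => 1 - Num.sqrt (1 - r ^+ 2)
  | 2 => Num.sqrt (1 - r ^+ 2) / 2 * (1 - Num.sqrt (1 - r ^+ 2))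
  | _ => omega_qw r
  end.

Context {H : completeNormedModType R[i]}.

Definition is_creation (r : R) (Phi : nat -> H) (Bp : H -> H) :=
  bounded_op Bp /\
  forall n, Bp (Phi n) = (Num.sqrt (omega_seq r n.+1))%:C *: Phi n.+1.

Definition is_annihilation (r : R) (Phi : nat -> H) (Bm : H -> H) :=
  [/\ bounded_op Bm, Bm (Phi 0) = 0 &
    forall n, Bm (Phi n.+1) = (Num.sqrt (omega_seq r n.+1))%:C *: Phi n].

Definition A_qw (Bm : H -> H) (lambda : R) : H -> H :=
  fun x => Bm x + (Num.sqrt lambda)%:C *: x.

Definition P_qw (Bp Bm : H -> H) (lambda : R) : H -> H :=
  (fun x => Bp x + (Num.sqrt lambda)%:C *: x) \o A_qw Bm lambda.

End QuantumWalk.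

(* Main.v *)
From HB Require Import structures.
Require Import Defs.
From mathcomp Require Import all_boot all_order all_algebra.
From mathcomp Require Import complex.
From mathcomp Require Import all_classical all_reals all_analysis.
From mathcomp Require Import ring lra.

(** Write [w] for the square root of [omega_qw r] and [s] for that of [lambda].
    The annihilation operator is a weighted backward shift whose weights are
    equal to [w] from the third one on, so after removal of that finite
    perturbation it is [w] times a coisometry, and the whole statement compares
    [s] with [w].

    Kernel of [Bm + s].  The equation [(Bm + s) x = 0] is a two-term recurrence
    for the coefficients of [x] in the basis [Phi]; its solutions are the
    multiples of [kernel_coef], which from index 2 on is geometric of ratio
    [- s / w].  This sequence is square summable exactly when [s < w]:
    - if [s < w], its partial sums converge to a kernel vector
      ([lowering_kernel]);
    - if [w <= s], its entries stay away from 0, so Bessel's inequality forces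
      a kernel vector to vanish ([lowering_injective]).

    Invertibility of [P = (Bp + s) (Bm + s)] when [w < s].  Both factors are
    invertible.  Neither [Bm] nor [Bp] need be bounded by [w] in norm, since
    the first weight can be close to [2 w]; but conjugation by the diagonal operator
    that multiplies [Phi 0] by 1/2 (for [Bm]) or by 2 (for [Bp]) halves that
    one weight and leaves the others alone.  The conjugate has norm at most
    [w < s], and the fixed point argument for contractions applies
    ([contraction_shift_invertible]).

    Conversely, if [P] is invertible then [Bm + s] is injective, whence
    [w <= s], and it is bounded below.  If [s = w], the partial sums of the
    kernel sequence contradict the lower bound: their norms are unbounded while
    their images under [Bm + s] are single terms of constant norm
    ([lowering_not_bounded_below]).

    The coefficients of [Bm x] and [Bp x] for an arbitrary [x] are known because
    [x] is the sum of its expansion ([expansion]) and the operators are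
    bounded. *)

Set Implicit Arguments.
Unset Strict Implicit.
Unset Printing Implicit Defensive.

Import Order.TTheory GRing.Theory Num.Theory.
Import numFieldNormedType.Exports.
Local Open Scope classical_set_scope.
Local Open Scope complex_scope.
Local Open Scope ring_scope.

(** * Limits in a complex Banach space *)

Section Hilbert.
Context {R : realType} {H : completeNormedModType R[i]}.
Implicit Types (x y : H) (T S : H -> H) (k m n : nat).

Lemma norm_realE x : `|x| = (complex.Re `|x|)%:C.
Proof. by rewrite RRe_real. Qed.

(** Cauchy criterion by comparison with a real sequence.  The exponent allows
    both a bound on the norm (geometric series, [k = 1]) and a Pythagorean
    identity (orthogonal series, [k = 2]). *)
Lemma cvg_norm_control k (u : nat -> H) (v : nat -> R) : (0 < k)%N ->
  cvgn v -> (forall m n, (m <= n)%N -> `|u n - u m| ^+ k <= (v n - v m)%:C) ->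
  cvgn u.
Proof.
move=> k0 /cauchy_cvgP/cauchy_ballP cv uv.
apply/cauchy_cvgP/cauchy_ballP => e e0.
have eE : e = (complex.Re e)%:C by rewrite RRe_real ?gtr0_real.
have r0 : 0 < complex.Re e by rewrite eE ltcR in e0.
have := cv _ (exprn_gt0 k r0); rewrite !near_map2 /=.
apply: filterS => -[m n] /=; rewrite -!ball_normE /= => vmn.
rewrite eE -(@ltr_pXn2r _ k) ?nnegrE ?normr_ge0 ?ler0c ?(ltW r0) // -rmorphXn /=.
have [mn|/ltnW nm] := leqP m n.
- rewrite distrC; apply: le_lt_trans (uv _ _ mn) _; rewrite ltcR.
  by apply: le_lt_trans (ler_norm _) _; rewrite distrC.
- apply: le_lt_trans (uv _ _ nm) _; rewrite ltcR.
  by apply: le_lt_trans (ler_norm _) _.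
Qed.

Lemma cvg_geometric_increments (u : nat -> H) (M q : R) : 0 <= q -> q < 1 ->
  (forall n, `|u n.+1 - u n| <= (M * q ^+ n)%:C) -> cvgn u.
Proof.
move=> q0 q1 uq.
apply: (@cvg_norm_control 1 u (series (geometric M q))) => //.
  by apply: is_cvg_geometric_series; rewrite ger0_norm.
move=> m; elim=> [|n IH]; first by rewrite leqn0 => /eqP->; rewrite !subrr normr0.
rewrite leq_eqVlt => /predU1P[->|]; first by rewrite !subrr normr0.
rewrite ltnS !expr1 => /IH; rewrite expr1 => {}IH.
have -> : u n.+1 - u m = (u n.+1 - u n) + (u n - u m) by rewrite addrA subrK.
apply: le_trans (ler_normD _ _) _.
rewrite seriesS -addrA rmorphD /=; exact: lerD.
Qed.

(** Passage to the limit for inequalities in [R[i]]: the quantities to be shown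
    null are dominated by the distance to the limit, which avoids any
    topological argument on the scalars. *)
Lemma eq0_of_le_cvg (u : nat -> H) (l : H) (a : R[i]) (K : R) :
  u n @[n --> \oo] --> l -> 0 <= a -> (forall n, a <= K%:C * `|u n - l|) -> a = 0.
Proof.
move=> ul a_ge0 aK; apply/eqP/negPn/negP => a0.
have {a_ge0}a0 : 0 < a by rewrite lt_def a0.
have K0 : 0 < K%:C.
  rewrite ltcR ltNge; apply/negP => K0; have := lt_le_trans a0 (aK 0%N).
  by move=> /lt_geF/negbT/negP; apply; rewrite mulr_le0_ge0 // lecR.
have /cvgrPdist_lt/(_ _ (divr_gt0 a0 K0))[N _ /(_ N (leqnn N))] /= := ul.
by rewrite distrC ltr_pdivlMr // mulrC => /lt_geF; rewrite aK.
Qed.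

(** The archimedean property, for the complex numbers that are real. *)
Lemma eq0_of_mulrn_le (z M : R[i]) : 0 <= z -> (forall n, z *+ n <= M) -> z = 0.
Proof.
move=> z0 zM; have M0 : 0 <= M by have := zM 0%N; rewrite mulr0n.
have zE : z = (complex.Re z)%:C by rewrite RRe_real ?ger0_real.
have ME : M = (complex.Re M)%:C by rewrite RRe_real ?ger0_real.
rewrite zE; rewrite zE ler0c in z0; congr (_%:C).
apply/eqP; rewrite eq_le z0 andbT leNgt; apply/negP => z_gt0.
have := zM (Num.truncn (complex.Re M / complex.Re z)).+1.
rewrite zE ME -rmorphMn lecR /= -mulr_natr -ler_pdivlMl // mulrC.
by rewrite leNgt truncnS_gt.
Qed.

(** The first two terms are discarded because the weights are constant only
    from index 2 on. *)
Lemma mulrn_le_sum (f : nat -> R[i]) (z : R[i]) n : (forall k, 0 <= f k) ->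
  (forall k, z <= f k.+2) -> z *+ n <= \sum_(k < n.+2) f k.
Proof.
move=> f0 zf; rewrite 2!big_ord_recl addrA ler_wpDl ?addr_ge0 //.
rewrite -[z *+ n](_ : \sum_(k < n) z = _); last by rewrite sumr_const card_ord.
by apply: ler_sum => k _; apply: zf.
Qed.

(** * Bounded operators and their inverses *)

Lemma bounded_op_linear T : bounded_op T -> exists L : {linear H -> H}, T = L.
Proof.
case=> linT _.
pose L : {linear H -> H} :=
  HB.pack T (GRing.isLinear.Build R[i] H H *:%R T linT).
by exists L.
Qed.

Lemma bounded_opP (L : {linear H -> H}) :
  bounded_op L <-> exists2 K : R, 0 < K & forall x, `|L x| <= K%:C * `|x|.
Proof.
split=> [[_ /linear_boundedP/pinfty_ex_gt0[K K0 LK]]|[K K0 LK]].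
  have KE : K = (complex.Re K)%:C by rewrite RRe_real ?gtr0_real.
  by exists (complex.Re K); rewrite -?KE //; rewrite KE ltcR in K0.
split; first exact: linearP.
apply/linear_boundedP; exists K%:C; split; first by rewrite complex_real.
by move=> M /ltW KM x; apply: le_trans (LK x) _; rewrite ler_wpM2r.
Qed.

Definition invertible_op T :=
  exists S, [/\ bounded_op S, cancel T S & cancel S T].

Lemma resolvent_set0 T : resolvent_set T 0 <-> invertible_op T.
Proof.
rewrite /resolvent_set /=.
suff -> : (fun x => T x - 0 *: x) = T by [].
by apply/funext => x; rewrite scale0r subr0.
Qed.

Lemma bounded_op_comp S T : bounded_op S -> bounded_op T -> bounded_op (S \o T).
Proof.
move=> bS bT; have [LS ES] := bounded_op_linear bS.
have [LT ET] := bounded_op_linear bT; subst S T.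
have [K K0 SK] := (bounded_opP _).1 bS; have [M M0 TM] := (bounded_opP _).1 bT.
apply/(bounded_opP (LS \o LT)); exists (K * M); first exact: mulr_gt0.
move=> x /=; apply: le_trans (SK _) _.
by rewrite rmorphM -mulrA ler_wpM2l ?TM // ler0c ltW.
Qed.

Lemma invertible_op_comp S T :
  invertible_op S -> invertible_op T -> invertible_op (S \o T).
Proof.
move=> [S' [bS SK KS]] [T' [bT TK KT]]; exists (T' \o S').
by split; [exact: bounded_op_comp | exact: can_comp | exact: can_comp].
Qed.

(** [L x + s x = y] says that [x] is a fixed point of [x |-> (y - L x) / s],
    a contraction of ratio [w / s].  The lower bound
    [(s - w) |x| <= |L x + s x|] gives injectivity and bounds the inverse. *)
Lemma contraction_shift_invertible (L : {linear H -> H}) (w s : R) :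
  0 <= w -> w < s -> (forall x, `|L x| <= w%:C * `|x|) ->
  invertible_op (fun x => L x + s%:C *: x).
Proof.
move=> w0 ws Lw; have s0 : 0 < s by apply: le_lt_trans ws.
have sw0 : 0 < s - w by rewrite subr_gt0.
have s0C : 0 < s%:C by rewrite ltcR.
have sN0 : s%:C != 0 by rewrite gt_eqF.
have bL : bounded_op L.
  apply/bounded_opP; exists s => // x; apply: le_trans (Lw x) _.
  by rewrite ler_wpM2r // lecR ltW.
have cL : continuous L by apply/linear_bounded_continuous; case: bL.
pose A x := L x + s%:C *: x.
have AB x y : A (x - y) = A x - A y.
  by rewrite /A linearB scalerBr opprD addrACA.
have low x : `|x| <= ((s - w)^-1)%:C * `|A x|.
  rewrite fmorphV /= ler_pdivlMl ?ltcR // rmorphB mulrBl /=.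
  have -> : s%:C * `|x| = `|A x - L x|.
    by rewrite /A addrAC subrr add0r normrZ ger0_norm // ler0c ltW.
  rewrite lerBlDr; apply: le_trans (ler_normB _ _) _; exact: lerD.
have injA : injective A.
  move=> x y Axy; apply/eqP; rewrite -subr_eq0 -normr_le0.
  by apply: le_trans (low _) _; rewrite AB Axy subrr normr0 mulr0.
have surA y : exists x, A x = y.
  pose g x := s%:C^-1 *: (y - L x); pose u := fun n => iter n g 0.
  have q0 : 0 <= w / s by rewrite divr_ge0 // ltW.
  have q1 : w / s < 1 by rewrite ltr_pdivrMr ?mul1r.
  have gq x z : `|g x - g z| <= (w / s)%:C * `|x - z|.
    have -> : g x - g z = (s%:C^-1) *: (L (z - x)).
      by rewrite (raddfB L) /g -scalerBr opprB addrC addrA subrK.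
    rewrite normrZ normfV (ger0_norm (ltW s0C)) ler_pdivrMl //.
    rewrite mulrA -rmorphM /= mulrCA divff ?gt_eqF // mulr1 distrC.
    exact: Lw.
  have cu : cvgn u.
    apply: (@cvg_geometric_increments u (complex.Re `|g 0|) (w / s)) => //.
    elim=> [|n IH]; first by rewrite /u /= subr0 expr0 mulr1 -norm_realE.
    apply: le_trans (gq _ _) _.
    rewrite exprS [X in _ <= (X)%:C]mulrCA [X in _ <= X]rmorphM.
    by apply: ler_wpM2l; [rewrite ler0c | exact: IH].
  exists (limn u).
  have gl : limn u = g (limn u).
    apply: (@cvg_unique _ _ (u n.+1 @[n --> \oo])) => //.
      by have := cu; rewrite -(cvg_shiftS u).
    by apply: cvgZr; apply: cvgB; [exact: cvg_cst | exact: (continuous_cvg _ (cL _))].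
  by rewrite /A {2}gl scalerA mulfV // scale1r addrC subrK.
have [S AS] := choice surA; have SA : cancel A S by move=> x; apply: injA.
exists S; split=> //.
have linS : linear S.
  move=> a x y; apply: injA; rewrite AS /A linearP scalerDr addrACA.
  by rewrite scalerA mulrC -scalerA -scalerDr -!/(A _) !AS.
pose S' : {linear H -> H} := HB.pack S (GRing.isLinear.Build R[i] H H *:%R S linS).
apply/(bounded_opP S'); exists (s - w)^-1; first by rewrite invr_gt0.
by move=> x; apply: le_trans (low _) _; rewrite /= AS.
Qed.

(** * Expansions in a complete orthonormal system *)

Section OrthonormalBasis.
Variables (ip : {dot H for Num.conj}) (Phi : nat -> H).
Hypotheses (ip_norm : norm_from_dot ip) (Phi_cons : complete_orthonormal ip Phi).
Implicit Types a : nat -> R[i].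

Definition lincomb a n : H := \sum_(k < n) a k *: Phi k.
Definition coef x k : R[i] := ip x (Phi k).

Lemma coefP k c x y : coef (c *: x + y) k = c * coef x k + coef y k.
Proof. by rewrite /coef linearPl. Qed.

Lemma coefB k x y : coef (x - y) k = coef x k - coef y k.
Proof. exact: linearBl. Qed.

Lemma coef_Phi k n : coef (Phi n) k = (n == k)%:R.
Proof. exact: Phi_cons.1. Qed.

Lemma norm_Phi n : `|Phi n| = 1.
Proof.
apply/eqP; rewrite -(@eqrXn2 _ 2) // ip_norm -/(coef _ _) coef_Phi eqxx.
by rewrite expr1n.
Qed.

Lemma coef_lincomb a n k : coef (lincomb a n) k = if (k < n)%N then a k else 0.
Proof.
elim: n => [|n IH]; first by rewrite /lincomb big_ord0 /coef linear0l.
rewrite /lincomb big_ord_recr /= addrC coefP coef_Phi IH ltnS.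
case: ltngtP => kn; first by rewrite mulr0 add0r.
- by rewrite mulr0 add0r.
- by rewrite mulr1 addr0 kn.
Qed.

Lemma ip_lincomb a n x : ip x (lincomb a n) = \sum_(k < n) (a k)^* * coef x k.
Proof.
rewrite /lincomb linear_sumr; apply: eq_bigr => k _.
by rewrite linearZr_LR.
Qed.

Lemma norm_lincomb a n : `|lincomb a n| ^+ 2 = \sum_(k < n) `|a k| ^+ 2.
Proof.
rewrite ip_norm ip_lincomb; apply: eq_bigr => k _.
by rewrite coef_lincomb ltn_ord normCK mulrC.
Qed.

(** The partial sum is the orthogonal projection of [x], hence Pythagoras. *)
Lemma norm_sub_lincomb x n : 
  `|x - lincomb (coef x) n| ^+ 2 = `|x| ^+ 2 - \sum_(k < n) `|coef x k| ^+ 2.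
Proof.
have E : ip x (lincomb (coef x) n) = \sum_(k < n) `|coef x k| ^+ 2.
  by rewrite ip_lincomb; apply: eq_bigr => k _; rewrite normCK mulrC.
rewrite ip_norm dnormB E -!ip_norm norm_lincomb.
rewrite opprD -addrA; congr (_ + _); rewrite addrA addrN add0r.
by congr (- _); rewrite rmorph_sum; apply: eq_bigr => k _; rewrite rmorphXn /= conj_normC.
Qed.

Lemma bessel x n : \sum_(k < n) `|coef x k| ^+ 2 <= `|x| ^+ 2.
Proof. by rewrite -subr_ge0 -norm_sub_lincomb exprn_ge0. Qed.

Lemma norm_coef_le x k : `|coef x k| <= `|x|.
Proof.
rewrite -(@ler_pXn2r _ 2) ?nnegrE //; apply: le_trans (bessel x k.+1).
by rewrite big_ord_recr /= lerDr sumr_ge0 // => i _; rewrite exprn_ge0.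
Qed.

Lemma eq_coef0 x : (forall k, coef x k = 0) -> x = 0.
Proof. exact: Phi_cons.2. Qed.

(** The partial sums are Cauchy because the sums of squared coefficients
    increase and are bounded (Bessel).  The difference between their limit and
    [x] has null coefficients, so it is 0 by completeness of the system. *)
Lemma expansion x : lincomb (coef x) n @[n --> \oo] --> x.
Proof.
pose v n : R := \sum_(k < n) complex.Re `|coef x k| ^+ 2.
have vE n : (v n)%:C = \sum_(k < n) `|coef x k| ^+ 2.
  rewrite /v rmorph_sum; apply: eq_bigr => k _.
  by rewrite rmorphXn.
have cv : cvgn v.
  apply: nondecreasing_is_cvgn.
    apply/nondecreasing_seqP => n; rewrite /v big_ord_recr lerDl /=.
    exact: sqr_ge0.
  exists (complex.Re `|x| ^+ 2) => _ [n _ <-].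
  by rewrite -lecR vE rmorphXn /= -norm_realE bessel.
have := @cvg_norm_control 2 _ v isT cv; move/(_ (lincomb (coef x))) => cp.
have {}cp : cvgn (lincomb (coef x)).
  apply: cp => m n mn; rewrite rmorphB /= !vE -!norm_lincomb.
  (* The m-th partial sum of [x] is also that of its n-th partial sum, so the
     Pythagorean identity applies to the latter. *)
  have pE : lincomb (coef x) m = lincomb (coef (lincomb (coef x) n)) m.
    apply: eq_bigr => k _; rewrite coef_lincomb.
    by rewrite (leq_trans (ltn_ord k) mn).
  by rewrite {1}pE norm_sub_lincomb pE (norm_lincomb _ m).
suff xE : limn (lincomb (coef x)) - x = 0.
  by rewrite -[X in _ --> X](subrK (limn (lincomb (coef x)))) -opprB xE oppr0 add0r.
apply: eq_coef0 => k.
apply/eqP; rewrite -normr_eq0; apply/eqP.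
(* From index k + 1 on, the partial sums have the same k-th coefficient
   as [x]. *)
apply: (@eq0_of_le_cvg (fun n => lincomb (coef x) (n + k.+1)%N)
  (limn (lincomb (coef x))) _ 1) => //.
  by rewrite (cvg_shiftn k.+1 (lincomb (coef x))).
move=> n; rewrite mul1r; apply: le_trans (norm_coef_le _ k).
by rewrite !coefB coef_lincomb addnS ltnS leq_addl distrC.
Qed.

Lemma eq_bounded_functional (f : H -> R[i]) (K : R) : scalar f ->
  (forall x, `|f x| <= K%:C * `|x|) -> (forall k, f (Phi k) = 0) ->
  forall x, f x = 0.
Proof.
move=> flin fK f0 x; apply/eqP; rewrite -normr_eq0; apply/eqP.
apply: (@eq0_of_le_cvg (lincomb (coef x)) x _ K) => [||n]; [exact: expansion|exact: normr_ge0|].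
have f00 : f 0 = 0.
  by have := flin (-1) 0 0; rewrite scaler0 addr0 mulN1r addNr.
suff <- : f (x - lincomb (coef x) n) = f x by rewrite distrC fK.
rewrite /lincomb; elim: n => [|n IH]; first by rewrite big_ord0 subr0.
rewrite big_ord_recr /= opprD addrA addrC -scaleNr flin f0 mulr0 add0r.
exact: IH.
Qed.

(** Half of Parseval's identity: it turns coefficientwise bounds into norm
    bounds. *)
Lemma norm_le_coef x (M : R[i]) : 0 <= M ->
  (forall n, \sum_(k < n) `|coef x k| ^+ 2 <= M ^+ 2) -> `|x| <= M.
Proof.
move=> M0 xM; have [//|Mx] := real_leP (normr_real x) (ger0_real M0).
suff /eqP : `|x| - M = 0 by rewrite subr_eq0 (gt_eqF Mx).
apply: (@eq0_of_le_cvg (lincomb (coef x)) x _ 1) => [||n].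
- exact: expansion.
- by rewrite subr_ge0 ltW.
rewrite mul1r lerBlDr.
rewrite -[x in `|x|](subrK (lincomb (coef x) n)) distrC.
apply: le_trans (ler_normD _ _) _; rewrite lerD2l.
by rewrite -(@ler_pXn2r _ 2) ?nnegrE // norm_lincomb.
Qed.

(** * Invertibility of shifted weighted shifts *)

Lemma norm_le_lowering x y (w : R[i]) : 0 <= w ->
  (forall k, `|coef y k| <= w * `|coef x k.+1|) -> `|y| <= w * `|x|.
Proof.
move=> w0 yx; apply: norm_le_coef => [|n]; first exact: mulr_ge0.
rewrite exprMn; apply: le_trans (_ : _ <= w ^+ 2 * \sum_(k < n.+1) `|coef x k| ^+ 2) _.
  rewrite big_ord_recl /= mulrDr mulr_sumr ler_wpDl ?mulr_ge0 ?exprn_ge0 //.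
  by apply: ler_sum => k _; rewrite -exprMn lerXn2r ?nnegrE ?mulr_ge0.
by rewrite ler_wpM2l ?bessel ?exprn_ge0.
Qed.

Lemma norm_le_raising x y (w : R[i]) : 0 <= w -> coef y 0 = 0 ->
  (forall k, `|coef y k.+1| <= w * `|coef x k|) -> `|y| <= w * `|x|.
Proof.
move=> w0 y0 yx; apply: norm_le_coef => [|n]; first exact: mulr_ge0.
rewrite exprMn; apply: le_trans (_ : _ <= w ^+ 2 * \sum_(k < n) `|coef x k| ^+ 2) _.
  case: n => [|n]; first by rewrite !big_ord0 mulr0.
  rewrite big_ord_recl [in X in _ <= X]big_ord_recr /= y0 normr0 expr0n /= add0r.
  rewrite mulrDr mulr_sumr ler_wpDr ?mulr_ge0 ?exprn_ge0 //.
  by apply: ler_sum => k _; rewrite -exprMn lerXn2r ?nnegrE ?mulr_ge0.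
by rewrite ler_wpM2l ?bessel ?exprn_ge0.
Qed.

(** The difference of the two sides is a bounded functional of [x] that vanishes
    on the basis. *)
Lemma coef_bounded_op (L : {linear H -> H}) (c : R[i]) k j : bounded_op L ->
  (forall n, coef (L (Phi n)) k = c * coef (Phi n) j) ->
  forall x, coef (L x) k = c * coef x j.
Proof.
move=> /bounded_opP[K K0 LK] Lc x; apply/eqP; rewrite -subr_eq0; apply/eqP.
move: x.
apply: (@eq_bounded_functional _ (K + complex.Re `|c|)) => [a x y|x|n].
- by rewrite linearP !coefP /=; ring.
- apply: le_trans (ler_normB _ _) _; rewrite rmorphD mulrDl.
  rewrite lerD //; first by apply: le_trans (norm_coef_le _ _) (LK _).
  by rewrite normrM; apply: ler_wpM2l (norm_coef_le _ _).
- by rewrite Lc subrr.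
Qed.

(** The diagonal operator with entries [c, 1, 1, ...].  Conjugation by it changes
    only the first weight of a weighted shift. *)
Definition scale_vacuum (c : R[i]) x : H := x + ((c - 1) * coef x 0) *: Phi 0.

Lemma scale_vacuum_linear c : linear (scale_vacuum c).
Proof.
move=> a x y; rewrite /scale_vacuum coefP mulrDr scalerDl scalerDr addrACA.
by rewrite mulrCA scalerA.
Qed.

HB.instance Definition _ c :=
  GRing.isLinear.Build R[i] H H *:%R (scale_vacuum c) (scale_vacuum_linear c).

Lemma coef_scale_vacuum c x k :
  coef (scale_vacuum c x) k = (if k is 0 then c else 1) * coef x k.
Proof.
rewrite /scale_vacuum addrC coefP coef_Phi; case: k => [|k] /=; last by ring.
by ring.
Qed.

Lemma scale_vacuumK c : c != 0 -> cancel (scale_vacuum c) (scale_vacuum c^-1).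
Proof.
move=> c0 x; apply/eqP; rewrite -subr_eq0; apply/eqP/eq_coef0 => k.
rewrite coefB !coef_scale_vacuum mulrA; case: k => [|k].
  by rewrite mulVf // mul1r subrr.
by rewrite !mul1r subrr.
Qed.

Lemma norm_scale_vacuum c x : `|scale_vacuum c x| <= (1 + `|c - 1|) * `|x|.
Proof.
apply: le_trans (ler_normD _ _) _; rewrite [X in _ <= X]mulrDl mul1r lerD2l normrZ.
by rewrite norm_Phi mulr1 normrM ler_wpM2l ?norm_coef_le.
Qed.

Lemma bounded_scale_vacuum c : bounded_op (scale_vacuum c).
Proof.
apply/(bounded_opP (scale_vacuum c)).
exists (1 + complex.Re `|c - 1|).
  by rewrite ltr_pwDl // -ler0c RRe_real.
by move=> x; rewrite rmorphD; exact: norm_scale_vacuum.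
Qed.

Lemma invertible_scale_vacuum c : c != 0 -> invertible_op (scale_vacuum c).
Proof.
move=> c0; exists (scale_vacuum c^-1); split; first exact: bounded_scale_vacuum.
  exact: scale_vacuumK.
by have := @scale_vacuumK c^-1; rewrite invrK invr_eq0; apply.
Qed.

Lemma conj_shift_invertible (L : {linear H -> H}) (c s : R[i]) : c != 0 ->
  invertible_op (fun x =>
    (scale_vacuum c \o L \o scale_vacuum c^-1) x + s *: x) ->
  invertible_op (fun x => L x + s *: x).
Proof.
move=> c0 iT; have ci0 : c^-1 != 0 by rewrite invr_eq0.
have := invertible_op_comp (invertible_scale_vacuum ci0)
  (invertible_op_comp iT (invertible_scale_vacuum c0)).
congr invertible_op; apply/funext => x /=.
by rewrite scale_vacuumK // -linearZ -linearD scale_vacuumK.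
Qed.

(** Multiplying [Phi 0] by 1/2 halves [b 0], which brings all the weights below
    [w]. *)
Lemma lowering_shift_invertible (L : {linear H -> H}) (b : nat -> R) (w s : R) :
  (forall k, 0 <= b k) -> b 0%N <= 2 * w -> (forall k, b k.+1 <= w) -> w < s ->
  (forall x k, coef (L x) k = (b k)%:C * coef x k.+1) ->
  invertible_op (fun x => L x + s%:C *: x).
Proof.
move=> b_ge0 b0 bw ws Lb.
have w0 : 0 <= w := le_trans (b_ge0 1%N) (bw 0%N).
have c0 : 2^-1 != 0 :> R[i] by rewrite invr_eq0 pnatr_eq0.
apply: (conj_shift_invertible c0); apply: contraction_shift_invertible ws _ => // x.
apply: norm_le_lowering => [|k]; first by rewrite ler0c.
rewrite /= coef_scale_vacuum Lb coef_scale_vacuum mul1r mulrA normrM ler_wpM2r //.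
case: k => [|k].
  rewrite normrM normfV (ger0_norm (ler0n _ 2)) ger0_norm ?ler0c //.
  by rewrite ler_pdivrMl ?ltr0n // -(rmorph_nat (real_complex R)) -rmorphM lecR.
by rewrite mul1r ger0_norm ?ler0c // lecR.
Qed.

(** For a forward shift the entry of [Phi 0] divides the first weight, so the
    conjugation goes the other way. *)
Lemma raising_shift_invertible (L : {linear H -> H}) (b : nat -> R) (w s : R) :
  (forall k, 0 <= b k) -> b 0%N <= 2 * w -> (forall k, b k.+1 <= w) -> w < s ->
  (forall x, coef (L x) 0 = 0) ->
  (forall x k, coef (L x) k.+1 = (b k)%:C * coef x k) ->
  invertible_op (fun x => L x + s%:C *: x).
Proof.
move=> b_ge0 b0 bw ws L0 Lb.
have w0 : 0 <= w := le_trans (b_ge0 1%N) (bw 0%N).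
have c0 : 2 != 0 :> R[i] by rewrite pnatr_eq0.
apply: (conj_shift_invertible c0); apply: contraction_shift_invertible ws _ => // x.
apply: norm_le_raising => [||k]; first by rewrite ler0c.
  by rewrite /= coef_scale_vacuum L0 mulr0.
rewrite /= coef_scale_vacuum Lb mul1r coef_scale_vacuum mulrA normrM ler_wpM2r //.
case: k => [|k].
  rewrite normrM normfV (ger0_norm (ler0n _ 2)) ger0_norm ?ler0c //.
  by rewrite ler_pdivrMr ?ltr0n // mulrC -(rmorph_nat (real_complex R)) -rmorphM lecR.
by rewrite mulr1 ger0_norm ?ler0c // lecR.
Qed.

(** * The kernel of a shifted backward shift *)

Section Lowering.
Variables (L : {linear H -> H}) (b : nat -> R) (w s : R).
Hypotheses (b_gt0 : forall k, 0 < b k) (b_tail : forall k, b k.+2 = w).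
Hypotheses (s_gt0 : 0 < s) (L0 : L (Phi 0) = 0).
Hypothesis Lb : forall k, L (Phi k.+1) = (b k)%:C *: Phi k.

(** The solution with value 1 at 0 of the recurrence
    [b k * a k.+1 + s * a k = 0] satisfied by the coefficients of a vector in
    the kernel of [L + s]. *)
Definition kernel_coef k : R := \prod_(j < k) - (s / b j).

Let w_gt0 : 0 < w. Proof. by rewrite -(b_tail 0). Qed.

Lemma kernel_coefS k : b k * kernel_coef k.+1 = - (s * kernel_coef k).
Proof.
rewrite /kernel_coef big_ord_recr /=; have := b_gt0 k => bk.
by field; rewrite gt_eqF.
Qed.

Lemma kernel_coef_neq0 k : kernel_coef k != 0.
Proof.
by apply/prodf_neq0 => j _; rewrite oppr_eq0 mulf_neq0 ?invr_eq0 ?gt_eqF.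
Qed.

Lemma norm_kernel_coef k :
  `|(kernel_coef k.+2)%:C| = `|(kernel_coef 2)%:C| * ((s / w) ^+ k)%:C.
Proof.
elim: k => [|k IH]; first by rewrite expr0 mulr1.
have -> : kernel_coef k.+3 = - (s / w) * kernel_coef k.+2.
  have := kernel_coefS k.+2; rewrite b_tail => E.
  apply: (mulfI (lt0r_neq0 w_gt0)); rewrite E.
  by field; rewrite gt_eqF.
rewrite rmorphM normrM IH exprS rmorphM mulrCA; congr (_ * _).
rewrite rmorphN normrN ger0_norm // ler0c divr_ge0 // ltW //.
Qed.

Notation "'A' x" := (L x + s%:C *: x) (at level 10, x at level 9).

(** The sum telescopes: by the recurrence only the last term survives. *)
Lemma shift_lincomb n : 
  A (lincomb (fun k => (kernel_coef k)%:C) n.+1) =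
  (s * kernel_coef n)%:C *: Phi n.
Proof.
elim: n => [|n IH].
  rewrite /lincomb big_ord_recr big_ord0 /= add0r linearZ /= L0 scaler0 add0r.
  by rewrite scalerA rmorphM.
rewrite /lincomb big_ord_recr /= -/(lincomb _ _) linearD scalerDr addrACA IH.
rewrite linearZ /= Lb !scalerA addrA -!rmorphM /= -scalerDl -rmorphD.
by rewrite [kernel_coef _ * b n]mulrC kernel_coefS addrN scale0r add0r.
Qed.

(** The limit [l] of the partial sums [u n] is in the kernel, since
    [A (u n.+1) = s (u n.+1 - u n)] tends to [s (l - l)]; its coefficient at 0
    is 1. *)
Lemma lowering_kernel : s < w -> bounded_op L -> exists2 x, x != 0 & A x = 0.
Proof.
move=> sw bL.
have cL : continuous L by apply/linear_bounded_continuous; case: bL.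
pose u n := lincomb (fun k => (kernel_coef k)%:C) n.+2.
have q0 : 0 <= s / w by rewrite divr_ge0 // ltW.
have q1 : s / w < 1 by rewrite ltr_pdivrMr ?mul1r.
have cu : cvgn u.
  apply: (@cvg_geometric_increments u `|kernel_coef 2| (s / w)) => // n.
  rewrite /u {1}/lincomb big_ord_recr /= addrAC subrr add0r normrZ norm_Phi mulr1.
  by rewrite norm_kernel_coef rmorphM normc_def expr0n addr0 sqrtr_sqr.
exists (limn u).
  apply/eqP => l0; have /eqP := oner_neq0 R[i]; apply.
  apply: (@eq0_of_le_cvg u (limn u) _ 1) => // n.
  rewrite l0 subr0 mul1r; apply: le_trans (norm_coef_le _ 0).
  by rewrite coef_lincomb /kernel_coef big_ord0 normr1.
have lu : u n.+1 @[n --> \oo] --> limn u by have := cu; rewrite -(cvg_shiftS u).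
apply: (@cvg_unique _ (@norm_hausdorff _ H) (A (u n.+1) @[n --> \oo])) => //.
  by apply: cvgD; [exact: (continuous_cvg _ (cL _)) | apply: cvgZr].
have -> : (fun n => A (u n.+1)) = (fun n => s%:C *: (u n.+1 - u n)).
  apply/funext => n; rewrite /u shift_lincomb [in RHS]/lincomb big_ord_recr /=.
  by rewrite addrAC subrr add0r scalerA rmorphM.
have -> : 0 = s%:C *: (limn u - limn u) by rewrite subrr scaler0.
by apply: cvgZr; exact: cvgB.
Qed.

(** A kernel vector has coefficients [kernel_coef k * coef x 0], of modulus at
    least [|kernel_coef 2 * coef x 0|] from index 2 on; these are square
    summable only if [coef x 0 = 0]. *)
Lemma lowering_injective : w <= s ->
  (forall x k, coef (L x) k = (b k)%:C * coef x k.+1) ->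
  forall x, A x = 0 -> x = 0.
Proof.
move=> ws Lcoef x Ax.
have xk k : coef x k = (kernel_coef k)%:C * coef x 0.
  elim: k => [|k IH]; first by rewrite /kernel_coef big_ord0 mul1r.
  have bk : (b k)%:C != 0 by rewrite fmorph_eq0 gt_eqF.
  apply: (mulfI bk); rewrite -Lcoef mulrA -rmorphM kernel_coefS.
  have := congr1 (coef^~ k) Ax.
  rewrite /= addrC coefP IH /coef linear0l -/(coef _ _) => /eqP.
  by rewrite addrC addr_eq0 => /eqP->; rewrite rmorphN rmorphM mulNr mulrA.
suff x0 : coef x 0 = 0 by apply: eq_coef0 => k; rewrite xk x0 mulr0.
have /eqP : `|(kernel_coef 2)%:C * coef x 0| ^+ 2 = 0.
  apply: (@eq0_of_mulrn_le _ (`|x| ^+ 2)) => [|n]; first exact: exprn_ge0.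
  apply: le_trans (bessel x n.+2); apply: (@mulrn_le_sum (fun k => `|coef x k| ^+ 2)) => k.
    exact: exprn_ge0.
  rewrite lerXn2r ?nnegrE ?normr_ge0 // (xk k.+2) !normrM (norm_kernel_coef k).
  apply: ler_wpM2r => //; apply: ler_peMr => //.
  by rewrite -(rmorph1 (real_complex R)) lecR exprn_ege1 // ler_pdivlMr ?mul1r.
rewrite expf_eq0 normr_eq0 mulf_eq0 fmorph_eq0 (negPf (kernel_coef_neq0 _)) /=.
by move/eqP.
Qed.

(** At the threshold the kernel sequence has constant modulus from index 2 on:
    its partial sums are approximate eigenvectors, of squared norm at least
    linear in their length, whose images have constant norm. *)
Lemma lowering_not_bounded_below (K : R) : s = w -> 0 <= K ->
  ~ forall x, `|x| <= K%:C * `|A x|.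
Proof.
move=> sw K0 low.
have /eqP : `|(kernel_coef 2)%:C| ^+ 2 = 0.
  apply: (@eq0_of_mulrn_le _ ((K%:C * (s%:C * `|(kernel_coef 2)%:C|)) ^+ 2)) => [|n].
    exact: exprn_ge0.
  have nk k : `|(kernel_coef k.+2)%:C| = `|(kernel_coef 2)%:C|.
    by rewrite (norm_kernel_coef k) sw divff ?gt_eqF // expr1n mulr1.
  pose u := lincomb (fun k => (kernel_coef k)%:C) n.+3.
  apply: le_trans (_ : _ <= `|u| ^+ 2) _.
    rewrite norm_lincomb big_ord_recr /= ler_wpDr ?exprn_ge0 //.
    by apply: (@mulrn_le_sum (fun k => `|(kernel_coef k)%:C| ^+ 2)) => k;
      rewrite ?exprn_ge0 ?nk.
  have sC_ge0 : 0 <= s%:C by rewrite ler0c ltW.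
  rewrite lerXn2r ?nnegrE ?normr_ge0 //; first by rewrite !mulr_ge0 // ler0c.
  apply: le_trans (low _) _; rewrite shift_lincomb normrZ norm_Phi mulr1 rmorphM normrM nk.
  by rewrite ger0_norm.
by rewrite expf_eq0 normr_eq0 fmorph_eq0 (negPf (kernel_coef_neq0 _)).
Qed.

End Lowering.
End OrthonormalBasis.
End Hilbert.

(** * The weights of the quantum walk *)

Section Weights.
Context {R : realType} (r : R).
Hypotheses (r_gt0 : 0 < r) (r_lt1 : r < 1).

Definition weight k : R := Num.sqrt (omega_seq r k.+1).
Definition tail_weight : R := Num.sqrt (omega_qw r).

Let t := Num.sqrt (1 - r ^+ 2).

Let t_bounds : [/\ 0 < t, t < 1 & t ^+ 2 = 1 - r ^+ 2].
Proof.
have r2 : 0 < 1 - r ^+ 2 by rewrite subr_gt0 expr_lt1 // ltW.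
have tE : t ^+ 2 = 1 - r ^+ 2 by rewrite sqr_sqrtr // ltW.
have t0 : 0 < t by rewrite sqrtr_gt0.
split=> //; rewrite -(@ltr_pXn2r _ 2) ?nnegrE ?(ltW t0) // tE expr1n.
by rewrite gtrBl exprn_gt0.
Qed.

Lemma omega_qw_gt0 : 0 < omega_qw r.
Proof. by rewrite divr_gt0 // exprn_gt0. Qed.

Lemma weight_gt0 k : 0 < weight k.
Proof.
have [t0 t1 tE] := t_bounds; rewrite sqrtr_gt0.
case: k => [|[|k]] /=; rewrite -?/t; [nra | nra | exact: omega_qw_gt0].
Qed.

Lemma weight_tail k : weight k.+2 = tail_weight.
Proof. by []. Qed.

(** With [t = sqrt (1 - r^2)] the inequality reads [1 - t <= 1 - t^2]: the
    first weight is [2 / sqrt (1 + t)] times the tail weight. *)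
Lemma weight0_le : weight 0 <= 2 * tail_weight.
Proof.
have [t0 t1 tE] := t_bounds.
have -> : 2 = Num.sqrt (2 ^+ 2) :> R by rewrite sqrtr_sqr ger0_norm.
rewrite -sqrtrM ?exprn_ge0 // ler_wsqrtr //= -/t /omega_qw; nra.
Qed.

(** Only the second weight is at stake, where the inequality reads
    [2 t <= 1 + t]. *)
Lemma weightS_le k : weight k.+1 <= tail_weight.
Proof.
have [t0 t1 tE] := t_bounds.
case: k => [|k] //; rewrite ler_wsqrtr //= -/t /omega_qw; nra.
Qed.

End Weights.

(** * The creation and annihilation operators *)

Section QuantumWalk.
Context {R : realType} {H : completeNormedModType R[i]}.
Variables (ip : {dot H for Num.conj}) (Phi : nat -> H).
Hypotheses (ip_norm : norm_from_dot ip) (Phi_cons : complete_orthonormal ip Phi).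
Variables (r : R) (Bp Bm : {linear H -> H}).
Hypotheses (HBp : is_creation r Phi Bp) (HBm : is_annihilation r Phi Bm).

Lemma coef_annihilation x k :
  coef ip Phi (Bm x) k = (weight r k)%:C * coef ip Phi x k.+1.
Proof.
have [bBm Bm0 BmS] := HBm.
apply: (coef_bounded_op ip_norm Phi_cons bBm) => -[|n].
  by rewrite Bm0 (coef_Phi Phi_cons) mulr0 /coef linear0l.
rewrite BmS -[_ *: _]addr0 coefP /coef linear0l addr0 -!/(coef _ _ _ _).
rewrite !(coef_Phi Phi_cons) eqSS; case: eqP => [->//|_]; by rewrite !mulr0.
Qed.

Lemma coef_creation0 x : coef ip Phi (Bp x) 0 = 0.
Proof.
have [bBp BpS] := HBp; rewrite -[RHS](mul0r (coef ip Phi x 0)).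
apply: (coef_bounded_op ip_norm Phi_cons bBp) => n.
rewrite BpS -[_ *: _]addr0 coefP /coef linear0l addr0 -!/(coef _ _ _ _).
by rewrite !(coef_Phi Phi_cons) mulr0 mul0r.
Qed.

Lemma coef_creationS x k :
  coef ip Phi (Bp x) k.+1 = (weight r k)%:C * coef ip Phi x k.
Proof.
have [bBp BpS] := HBp.
apply: (coef_bounded_op ip_norm Phi_cons bBp) => n.
rewrite BpS -[_ *: _]addr0 coefP /coef linear0l addr0 -!/(coef _ _ _ _).
rewrite !(coef_Phi Phi_cons) eqSS; case: eqP => [->//|_]; by rewrite !mulr0.
Qed.

End QuantumWalk.

Theorem lemma4p5 (R : realType) (H : completeNormedModType R[i])
    (ip : {dot H for Num.conj}) (Hip : norm_from_dot ip)
    (Phi : nat -> H) (HPhi : complete_orthonormal ip Phi)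
    (r : R) (r_gt0 : 0 < r) (r_lt1 : r < 1)
    (Bp Bm : H -> H)
    (HBp : is_creation r Phi Bp) (HBm : is_annihilation r Phi Bm)
    (lambda : R) (lambda_gt0 : 0 < lambda) :
  (injective (A_qw Bm lambda) <-> omega_qw r <= lambda) /\
  (~ spectrum (P_qw Bp Bm lambda) 0 <-> omega_qw r < lambda).
Proof.
have [bBp _] := HBp; have [bBm Bm0 BmS] := HBm.
have [Lp Ep] := bounded_op_linear bBp; have [Lm Em] := bounded_op_linear bBm.
subst Bp Bm; set s := Num.sqrt lambda.
have s_gt0 : 0 < s by rewrite sqrtr_gt0.
have omega_gt0 := omega_qw_gt0 r_gt0.
have le_ws : (tail_weight r <= s) = (omega_qw r <= lambda).
  by rewrite ler_sqrt // ltW.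
have lt_ws : (tail_weight r < s) = (omega_qw r < lambda) by rewrite ltr_sqrt.
have lt_sw : (s < tail_weight r) = (lambda < omega_qw r) by rewrite ltr_sqrt.
have b_gt0 := weight_gt0 r_gt0 r_lt1.
have b_tail := weight_tail r.
have part1 : injective (A_qw Lm lambda) <-> omega_qw r <= lambda.
  split=> [injA|].
    rewrite leNgt -lt_sw; apply/negP => sw.
    have [x /negP + Ax] := lowering_kernel Hip HPhi b_gt0 b_tail s_gt0 Bm0 BmS sw bBm.
    by apply; apply/eqP/injA; rewrite {1}/A_qw Ax /A_qw linear0 scaler0 addr0.
  rewrite -le_ws => ws x y Axy; apply/eqP; rewrite -subr_eq0; apply/eqP.
  apply: (lowering_injective Hip HPhi b_gt0 b_tail s_gt0 ws).
    exact: coef_annihilation Hip HPhi r Lm HBm.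
  by rewrite linearB scalerBr addrACA -opprD; apply/eqP; rewrite subr_eq0; apply/eqP.
split=> //.
have -> : ~ spectrum (P_qw Lp Lm lambda) 0 <-> invertible_op (P_qw Lp Lm lambda).
  by rewrite -resolvent_set0; split=> [/contrapT//|? ?].
split=> [[S [bS PS _]]|].
  have [LS ES] := bounded_op_linear bS; subst S.
  have injA : injective (A_qw Lm lambda).
    by move=> x y Axy; apply: (can_inj PS); rewrite /P_qw /= Axy.
  rewrite lt_neqAle (part1.1 injA) andbT; apply/eqP => E.
  have [K K0 SK] := (bounded_opP _).1 bS; have [M M0 BM] := (bounded_opP _).1 bBp.
  have sw : s = tail_weight r by rewrite /s -E.
  apply: (lowering_not_bounded_below Hip HPhi b_gt0 b_tail s_gt0 Bm0 BmS
    (K := K * (M + s)) sw).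
    by rewrite mulr_ge0 ?addr_ge0 // ltW.
  move=> x; rewrite -{1}(PS x); apply: le_trans (SK _) _.
  rewrite rmorphM -mulrA ler_wpM2l ?ler0c ?(ltW K0) //.
  apply: le_trans (ler_normD _ _) _; rewrite rmorphD mulrDl lerD ?BM //.
  by rewrite normrZ ger0_norm // ler0c ltW.
rewrite -lt_ws => ws; apply: invertible_op_comp.
  apply: (raising_shift_invertible Hip HPhi (b := weight r) (w := tail_weight r)) ws _ _.
  - by move=> k; apply: ltW.
  - exact: (weight0_le r_gt0 r_lt1).
  - exact: (weightS_le r_gt0 r_lt1).
  - move=> x; exact: (coef_creation0 Hip HPhi HBp).
  - move=> x k; exact: (coef_creationS Hip HPhi HBp).
apply: (lowering_shift_invertible Hip HPhi (b := weight r) (w := tail_weight r)) ws _.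
- by move=> k; apply: ltW.
- exact: (weight0_le r_gt0 r_lt1).
- exact: (weightS_le r_gt0 r_lt1).
- move=> x k; exact: (coef_annihilation Hip HPhi HBm).
Qed.
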